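(* Let $H$ be a real Hilbert space, $C\subseteq H$ a nonempty, convex and closed set, and $F:H\to H$ an operator such that the solution set $\Omega$ of $\mathrm{VI}(F,C)$ is nonempty. Assume that $F$ is pseudo-monotone on $H$, Lipschitz continuous (with some constant $L>0$) and sequentially weak-to-weak continuous. Let $(\rho_n)_{n\ge0}\subseteq[0,1]$ with $\liminf_{n\to+\infty}\rho_n>0$, $\mu\in(0,1)$ and $\lambda_0>0$. Let $x_0\in H$ and let, for all $n\ge0$, $$y_n=P_C(x_n-\lambda_n F(x_n)),\qquad x_{n+1}=\rho_n\left(y_n+\lambda_n(F(x_n)-F(y_n))\right)+(1-\rho_n)x_n,$$ $$\lambda_{n+1}=\begin{cases}\min\left\{\dfrac{\mu\|x_n-y_n\|}{\|F(x_n)-F(y_n)\|},\lambda_n\right\}, & \text{if } F(x_n)-F(y_n)\neq0,\\ \lambda_n, & \text{otherwise},\end{cases}$$ and assume that $x_n\ne y_n$ and $F(y_n)\neq0$ for every $n\ge0$. Then the sequence $(x_n)_{n\ge0}$ converges weakly to a solution of $\mathrm{VI}(F,C)$.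
   Context: $\mathrm{VI}(F,C)$ is the problem of finding $x^*\in C$ such that $\langle F(x^* ),x-x^*\rangle\ge 0$ for all $x\in C$; $\Omega$ denotes its solution set. $P_C$ is the metric projection onto $C$. $F$ is pseudo-monotone on a set $S\subseteq H$ if for all $x,y\in S$: $\langle F(x),y-x\rangle\ge 0\Rightarrow\langle F(y),y-x\rangle\ge0$. $F$ is Lipschitz continuous with constant $L$ if $\|F(x)-F(y)\|\le L\|x-y\|$ for all $x,y\in H$. $F$ is sequentially weak-to-weak continuous if $x_n\rightharpoonup x$ implies $F(x_n)\rightharpoonup F(x)$. The iteration is Tseng's forward-backward-forward algorithm with relaxation parameters $(\rho_n)$ and adaptive stepsizes $(\lambda_n)$; the algorithm stops if $y_n=x_n$ or $F(y_n)=0$, and the assumption that this never occurs means that it generates an infinite sequence. *)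

(* Defs.v *)
From HB Require Import structures.
From mathcomp Require Import all_boot all_order all_algebra.
From mathcomp Require Import all_classical all_reals all_analysis.

Set Implicit Arguments.
Unset Strict Implicit.
Unset Printing Implicit Defensive.

Import Order.TTheory GRing.Theory Num.Theory.
Import numFieldNormedType.Exports.

Local Open Scope classical_set_scope.
Local Open Scope ring_scope.

(* A real Hilbert space is a complete normed module H over R : realType with a
   dot product dot : {dot H for idfun} (bilinear, symmetric, positive definite)
   whose associated norm is the norm of H. *)
Definition hilbert_dot (R : realType) (H : completeNormedModType R)
    (dot : {dot H for idfun}) : Prop :=
  forall u : H, dot u u = `|u| ^+ 2.

Definition weakly_cvg (R : realType) (H : completeNormedModType R)
    (dot : {dot H for idfun}) (u : nat -> H) (l : H) : Prop :=
  forall z : H, dot (u n) z @[n --> \oo] --> dot l z.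

Definition seq_weak_continuous (R : realType) (H : completeNormedModType R)
    (dot : {dot H for idfun}) (F : H -> H) : Prop :=
  forall (u : nat -> H) (l : H),
    weakly_cvg dot u l -> weakly_cvg dot (F \o u) (F l).

Definition pseudo_monotone_on (R : realType) (H : completeNormedModType R)
    (dot : {dot H for idfun}) (S : set H) (F : H -> H) : Prop :=
  forall x y : H, S x -> S y ->
    0 <= dot (F x) (y - x) -> 0 <= dot (F y) (y - x).

Definition VI_solutions (R : realType) (H : completeNormedModType R)
    (dot : {dot H for idfun}) (F : H -> H) (C : set H) : set H :=
  [set xs | C xs /\ forall x : H, C x -> 0 <= dot (F xs) (x - xs)].

(* Total function: when C is nonempty, closed and convex the minimizer exists
   and is unique; the default value x matters only when there is none. *)
Definition metric_proj (R : realType) (H : completeNormedModType R)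
    (C : set H) (x : H) : H :=
  xget x [set p | C p /\ forall c : H, C c -> `|x - p| <= `|x - c|].

(* Main.v *)
(* Write e_n = x_n - y_n.  The variational inequality of the projection and
   pseudo-monotonicity give, for every solution u,
     |x_{n+1} - u|^2 <= |x_n - u|^2
       - rho_n (|e_n|^2 - lambda_n^2 |F x_n - F y_n|^2).
   The stepsizes decrease to a positive limit, so lambda_n / lambda_{n+1} -> 1
   and eventually lambda_n |F x_n - F y_n| <= q |e_n| with q < 1.  Hence
   |x_n - u| converges and e_n -> 0, and by Opial's argument it remains to see
   that a weak cluster point p solves the variational inequality.  If
   w = F p <> 0 then, for c in C and t > 0, <F y_n, c + t w - y_n> is
   eventually nonnegative because its t-part tends to t |w|^2;
   pseudo-monotonicity moves F to the fixed point c + t w, where the weak limit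
   can be taken, and a Minty-type limit along c := p + t (c - p) concludes. *)

Require Import Defs.
From HB Require Import structures.
From mathcomp Require Import all_boot all_order all_algebra.
From mathcomp Require Import all_classical all_reals all_analysis.
From mathcomp Require Import ring lra.

Set Implicit Arguments.
Unset Strict Implicit.

Import Order.TTheory GRing.Theory Num.Theory.
Import numFieldNormedType.Exports.

Local Open Scope classical_set_scope.
Local Open Scope ring_scope.

(** * Closedness by approximation, and segments in convex sets *)

Lemma closed_approx (R : realType) (H : normedModType R) (T : set H) :
  (forall z, (forall e : R, 0 < e -> exists2 v, T v & `|z - v| < e) -> T z) ->
  closed T.
Proof.
move=> hT z clz; apply: hT => e e0.
have [v [Tv zv]] := clz _ (nbhsx_ballx z e e0).
by exists v => //; move: zv; rewrite -ball_normE.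
Qed.

Lemma convex_set_segment (R : realType) (H : lmodType R) (C : set H) (a b : H)
  (t : R) : convex_set C -> C a -> C b -> 0 <= t <= 1 ->
  C (a + t *: (b - a)).
Proof.
move=> cC Ca Cb /andP[t0 t1].
have := cC b a (Itv01 t0 t1).
rewrite !inE => /(_ Cb Ca) /=; rewrite /conv /=.
by congr C; rewrite /= scalerBl scale1r scalerBr addrCA.
Qed.

(** * Inner product calculus *)

Section Hilbert.
Context (R : realType) (H : completeNormedModType R) (dot : {dot H for idfun}).
Hypothesis dotE : hilbert_dot dot.
Implicit Types (u v w : H) (a : R).

Lemma dotC u v : dot u v = dot v u.
Proof. have := @hermitian_subproof _ _ _ _ dot u v. by rewrite expr0 mul1r. Qed.

Lemma dotDl u v w : dot (u + v) w = dot u w + dot v w.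
Proof. by rewrite linearDl. Qed.

Lemma dotNl u w : dot (- u) w = - dot u w.
Proof. by rewrite linearNl. Qed.

Lemma dotZl a u w : dot (a *: u) w = a * dot u w.
Proof. by rewrite linearZl_LR. Qed.

Lemma dotDr u v w : dot w (u + v) = dot w u + dot w v.
Proof. by rewrite linearDr. Qed.

Lemma dotNr u w : dot w (- u) = - dot w u.
Proof. by rewrite linearNr. Qed.

Lemma dotZr a u w : dot w (a *: u) = a * dot w u.
Proof. by rewrite linearZr. Qed.

Definition dot_lin := (dotDl, dotDr, dotNl, dotNr, dotZl, dotZr).

Lemma sqr_normD u v : `|u + v| ^+ 2 = `|u| ^+ 2 + 2 * dot u v + `|v| ^+ 2.
Proof. by rewrite -!dotE !dot_lin (dotC v u); ring. Qed.

(** Cauchy-Schwarz is read off the triangle inequality: expand both squares in |u + v|^2 <= (|u| +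
    |v|)^2. *)
Lemma dot_le u v : dot u v <= `|u| * `|v|.
Proof.
have : `|u + v| ^+ 2 <= (`|u| + `|v|) ^+ 2.
  by rewrite ler_sqr ?nnegrE ?addr_ge0// ler_normD.
rewrite sqr_normD; nra.
Qed.

Lemma normr_dot_le u v : `|dot u v| <= `|u| * `|v|.
Proof.
rewrite ler_norml dot_le andbT lerNl -dotNl.
by rewrite (le_trans (dot_le _ _))// normrN.
Qed.

Lemma dot_eq0 u : dot u u = 0 -> u = 0.
Proof. by rewrite dotE => /eqP; rewrite sqrf_eq0 normr_eq0 => /eqP. Qed.

Lemma cvg_dotl (T : Type) (F : set_system T) (FF : Filter F) (f : T -> H) l z :
  f @ F --> l -> dot (f t) z @[t --> F] --> dot l z.
Proof.
move=> fl; apply/cvgrPdist_le => e e0.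
have z0 : 0 < `|z| + 1 by rewrite ltr_wpDl.
have e'0 : 0 < e / (`|z| + 1) by rewrite divr_gt0.
move/cvgrPdist_le : fl => /(_ _ e'0); apply: filterS => t ht.
rewrite -dotNl -dotDl (le_trans (normr_dot_le _ _))//.
apply: (@le_trans _ _ (e / (`|z| + 1) * `|z|)).
  by rewrite ler_wpM2r.
rewrite mulrAC ler_pdivrMr// ler_wpM2l ?lerDl// ltW//.
Qed.

(** The parallelogram law for x - u and x - v; the midpoint is written in the form of
    [convex_set_segment]. *)
Lemma parallelogram_midpoint x u v :
  `|u - v| ^+ 2 =
  2 * `|x - u| ^+ 2 + 2 * `|x - v| ^+ 2 - 4 * `|x - (u + 2^-1 *: (v - u))| ^+ 2.
Proof.
rewrite -!dotE !dot_lin (dotC v u) (dotC u x) (dotC v x); lra.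
Qed.

(** * Metric projection onto a closed convex set *)

Section Projection.
Variable C : set H.
Hypotheses (C0 : C !=set0) (Ccvx : convex_set C) (Ccl : closed C).

(** A minimizing sequence is Cauchy: midpoints stay in [C], so their squared distance to x is at
    least [D], and the parallelogram law bounds |c n - c m|^2 by the excesses over [D]. *)
Lemma nearest_point_exists x :
  exists p, C p /\ forall c, C c -> `|x - p| <= `|x - c|.
Proof.
pose S := [set `|x - c| ^+ 2 | c in C].
have S0 : S !=set0 by case: C0 => c Cc; exists (`|x - c| ^+ 2); exists c.
have lbS : lbound S 0 by move=> _ [c _ <-]; exact: sqr_ge0.
have hiS : has_inf S by split => //; exists 0.
pose D := inf S.
have DS c : C c -> D <= `|x - c| ^+ 2.
  by move=> Cc; apply: ge_inf; [exists 0|exists c].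
have /choice[c hc] : forall n : nat, exists c, C c /\
    `|x - c| ^+ 2 < D + n.+1%:R^-1.
  move=> n; have [_ [c Cc <-] h] : exists2 s, S s & s < D + n.+1%:R^-1.
    exact: inf_adherent.
  by exists c.
have cc n m : `|c n - c m| ^+ 2 <= 2 * n.+1%:R^-1 + 2 * m.+1%:R^-1.
  rewrite (parallelogram_midpoint x).
  have [Cn hn] := hc n; have [Cm hm] := hc m.
  have := DS _ (@convex_set_segment _ _ _ _ _ 2^-1 Ccvx Cn Cm _).
  have -> : 0 <= (2^-1 : R) <= 1 by lra.
  move=> /(_ isT); move: hn hm; move: (n.+1%:R^-1) (m.+1%:R^-1) => a b; lra.
have cauchyc : cauchy (c @ \oo).
  apply: cauchy_exP => e e0.
  (* Both reciprocals in [cc] fall below e^2/4, and four times this bound is e^2. *)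
  have e20 : 0 < e ^+ 2 / 4 by rewrite divr_gt0 ?exprn_gt0.
  have [N _ hN] := @near_infty_natSinv_lt R (PosNum e20).
  exists (c N); exists N => // n /= Nn; rewrite -ball_normE /=.
  rewrite -(@ltr_pXn2r _ 2) ?nnegrE ?(ltW e0)//.
  have := hN _ (leqnn N); have := hN _ Nn; have := cc N n => /=.
  by move: (N.+1%:R^-1) (n.+1%:R^-1) => a b; lra.
have /cvg_ex[/= p cp] : cvg (c @ \oo) by exact: cauchy_cvg.
have Cp : C p.
  by apply: (closed_cvg _ Ccl _ _ cp) => //; apply: nearW => n; case: (hc n).
exists p; split => // c' Cc'.
rewrite -(@ler_pXn2r _ 2) ?nnegrE//; apply: le_trans (DS _ Cc').
apply: (@ler_cvg_to _ \oo _ _ (fun n => `|x - c n| ^+ 2) (fun n => D + n.+1%:R^-1)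
  (`|x - p| ^+ 2) D).
- rewrite expr2; under eq_fun do rewrite expr2.
  by apply: cvgM; apply: cvg_norm; apply: cvgB => //; exact: cvg_cst.
- rewrite -[X in _ --> X]addr0; apply: cvgD; first exact: cvg_cst.
  exact: cvg_harmonic.
- by apply: nearW => n; case: (hc n) => _ /ltW.
Qed.

Lemma metric_projP x :
  C (metric_proj C x) /\ forall c, C c -> `|x - metric_proj C x| <= `|x - c|.
Proof.
rewrite /metric_proj; case: xgetP => [_ -> //|] /= h.
by have [p] := nearest_point_exists x; move=> /(h p).
Qed.

Lemma metric_proj_dot_le0 x c : C c ->
  dot (x - metric_proj C x) (c - metric_proj C x) <= 0.
Proof.
move=> Cc; have [Cp pmin] := metric_projP x.
set p := metric_proj C x in Cp pmin *.
rewrite leNgt; apply/negP => a0.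
set a := dot _ _ in a0; pose b := `|c - p| ^+ 2.
have b0 : 0 <= b by exact: sqr_ge0.
(* With a > 0, moving from p towards c by t = a/(a + b) contradicts minimality, which gives 2a <= t
   b, whereas t b = a - t a < a. The denominator a + b also covers b = 0. *)
have t01 : 0 <= a / (a + b) <= 1.
  have ab0 : 0 < a + b by lra.
  by rewrite divr_ge0 ?ler_pdivrMr ?mul1r ?lerDl//= ?ltW//.
have := pmin _ (convex_set_segment Ccvx Cp Cc t01).
set t := a / (a + b) in t01 *.
rewrite -(@ler_pXn2r _ 2) ?nnegrE// opprD addrA (sqr_normD (x - p)).
rewrite normrN dotNr dotZr.
rewrite normrZ exprMn -/a -/b real_normK ?num_real//.
have tE : t * (a + b) = a by rewrite /t divfK// gt_eqF//; lra.
have t0 : 0 < t by rewrite /t divr_gt0//; lra.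
move=> h.
have {}h : 2 * a <= t * b by rewrite -(ler_pM2l t0); lra.
nra.
Qed.

End Projection.

(** * Orthogonal projection and the Riesz representation *)

Section Subspace.
Variable T : set H.
Hypotheses (T0 : T 0) (TD : forall u v, T u -> T v -> T (u + v))
  (TZ : forall a u, T u -> T (a *: u)) (Tcl : closed T).

(** In a subspace the projection inequality may be tested at p + v and p - v, which turns it into an
    equality. *)
Lemma orthogonal_projection z :
  exists2 p, T p & forall v, T v -> dot (z - p) v = 0.
Proof.
have Tcvx : convex_set T.
  by move=> u v t; rewrite !inE => Tu Tv; apply: TD; exact: TZ.
have Tn : T !=set0 by exists 0.
exists (metric_proj T z); first by case: (metric_projP Tn Tcvx Tcl z).
have [Tp _] := metric_projP Tn Tcvx Tcl z.
set p := metric_proj T z in Tp *.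
have le0 v : T v -> dot (z - p) v <= 0.
  move=> Tv; have := metric_proj_dot_le0 Tn Tcvx Tcl z (TD Tp Tv).
  by rewrite -/p addrAC subrr add0r.
move=> v Tv; apply/eqP; rewrite eq_le le0//=.
by have := le0 _ (TZ (-1) Tv); rewrite dotZr; lra.
Qed.

End Subspace.

(** If f u <> 0, let q be the component of u orthogonal to the kernel of f. Every v - (f v / f q) q
    lies in the kernel, hence is orthogonal to q, so a multiple of q represents f. Linearity is
    stated as equations because f will be a pointwise limit obtained by choice. *)
Lemma Riesz_representation (f : H -> R) (M : R) :
  (forall u v, f (u + v) = f u + f v) ->
  (forall a u, f (a *: u) = a * f u) ->
  (forall u, `|f u| <= M * `|u|) ->
  exists p, forall u, f u = dot p u.
Proof.
move=> fD fZ fM.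
have [f0|/existsNP[u /eqP fu]] := pselect (forall u, f u = 0).
  by exists 0 => u; rewrite f0 linear0l.
have fB v w : f (v - w) = f v - f w by rewrite fD -scaleN1r fZ mulN1r.
have M0 : 0 <= M.
  have u0 : 0 < `|u|.
    rewrite normr_gt0; apply: contraNneq fu => ->.
    by rewrite -(scale0r 0) fZ mul0r.
  by have := le_trans (normr_ge0 _) (fM u); rewrite pmulr_lge0.
have [||||q0 Tq0 qT] := @orthogonal_projection [set v | f v = 0] _ _ _ _ u.
- by rewrite /= -(scale0r 0) fZ mul0r.
- by move=> v w /= fv fw; rewrite fD fv fw addr0.
- by move=> a v /= fv; rewrite fZ fv mulr0.
- apply: closed_approx => z hz /=; apply/eqP; rewrite -normr_le0.
  apply/ler_addgt0Pl => e e0; rewrite addr0.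
  have M1 : 0 < M + 1 by lra.
  have [|v /= fv zv] := hz (e / (M + 1)); first by rewrite divr_gt0.
  rewrite -(subr0 (f z)) -fv -fB (le_trans (fM _))//.
  move: zv; rewrite ltr_pdivlMr// => zv.
  have := normr_ge0 (z - v); nra.
pose q := u - q0.
have fq : f q = f u by rewrite fB Tq0 subr0.
have q20 : dot q q != 0.
  apply: contraNneq fu => /dot_eq0 q0'; rewrite -fq q0'.
  by rewrite -(scale0r 0) fZ mul0r.
exists ((f q / dot q q) *: q) => v; rewrite dotZl.
have := qT (v - (f v / f q) *: q); rewrite /= -/q fB fZ.
rewrite divfK ?fq// subrr => /(_ erefl); rewrite dotDr dotNr dotZr.
move=> /eqP; rewrite subr_eq0 => /eqP ->.
by field; rewrite fu q20.
Qed.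

(** * Weak sequential compactness of bounded sequences *)

Lemma ultrafilter_cvg_itv (U : set_system nat) (UU : UltraFilter U)
  (f : nat -> R) (a b : R) : (forall n, a <= f n <= b) ->
  exists2 l, a <= l <= b & f n @[n --> U] --> l.
Proof.
move=> fab; have PU := @ultra_proper _ _ UU.
have [|l [labl cl]] := @segment_compact R a b (f @ U) _.
  by apply: (@filterE _ U) => n /=; rewrite in_itv /=; exact: fab.
exists l; first by move: labl; rewrite /= in_itv.
move=> B Bl /=.
(* An ultrafilter contains the preimage of [B] or that of its complement; the second would
   contradict that l is a cluster point. *)
have [//|UB] := in_ultra_setVsetC (f @^-1` B) UU.
by have [r [/= ? ?]] := cl (~` B) B UB Bl.
Qed.

(* The weak limit p is taken along an ultrafilter, which makes it linear in the
   test vector; a subsequence is then chosen to converge to p against every x k.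
   The test vectors for which it converges form a closed subspace that contains
   all the x k and everything orthogonal to them, hence the whole space. *)
Theorem bounded_weakly_cvg_subseq (x : nat -> H) (M : R) :
  (forall n, `|x n| <= M) ->
  exists phi : nat -> nat, exists p : H,
    (forall n, (n <= phi n)%N) /\ weakly_cvg dot (x \o phi) p.
Proof.
move=> xM.
have M0 : 0 <= M by exact: le_trans (normr_ge0 _) (xM 0%N).
have [U [UU ooU]] := ultraFilterLemma eventually_filter.
have PU := @ultra_proper _ _ UU.
have /choice[f hf] : forall z, exists l, `|l| <= M * `|z| /\
    dot (x n) z @[n --> U] --> l.
  move=> z; have [|l lb hl] := @ultrafilter_cvg_itv U UU
      (fun n => dot (x n) z) (- (M * `|z|)) (M * `|z|).
    move=> n; rewrite -ler_norml (le_trans (normr_dot_le _ _))//.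
    by rewrite ler_wpM2r.
  by exists l; rewrite ler_norml.
have fl z : dot (x n) z @[n --> U] --> f z by case: (hf z).
have lim_eq (g : nat -> R) (l m : R) :
    g n @[n --> U] --> l -> g n @[n --> U] --> m -> l = m.
  by move=> gl gm; apply: (cvg_unique _ gl gm); exact: Rhausdorff.
have [| | |p fp] := @Riesz_representation f M.
- move=> u v; apply: (lim_eq (fun n => dot (x n) (u + v))) => //.
  by under eq_fun do rewrite dotDr; exact: cvgD.
- move=> a u; apply: (lim_eq (fun n => dot (x n) (a *: u))) => //.
  by under eq_fun do rewrite dotZr; apply: cvgM => //; exact: cvg_cst.
- by move=> u; case: (hf u).
(* Stage n handles the finitely many test vectors x 0, ..., x n with error 1/(n+1): a finite
   intersection of members of [U] is nonempty. The condition n <= phi n, in place of monotonicity,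
   makes [phi] tend to infinity. *)
have /choice[phi hphi] : forall n, exists m, (n <= m)%N /\
    forall k, (k <= n)%N -> `|dot (x m - p) (x k)| < n.+1%:R^-1.
  move=> n; apply: (@filter_ex _ U); apply: filterI.
    by apply: ooU; exists n.
  suff h N : U [set m | forall k, (k < N)%N ->
      `|dot (x m - p) (x k)| < n.+1%:R^-1].
    by have := h n.+1; apply: filterS => m /= hm k kn; exact: hm.
  elim: N => [|N IH]; first exact: filterE.
  have /cvgrPdist_lt/(_ n.+1%:R^-1) := fl (x N).
  rewrite invr_gt0 ltr0n => /(_ isT) hN.
  apply: filterS (filterI IH hN) => m /= [h1 h2] k.
  rewrite ltnS leq_eqVlt => /orP[/eqP ->|]; last exact: h1.
  by rewrite distrC fp in h2; rewrite dotDl dotNl.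
exists phi, p; split; first by move=> n; case: (hphi n).
pose w n := x (phi n) - p.
have wB n : `|w n| <= M + `|p|.
  by rewrite (le_trans (ler_normB _ _))// lerD2r.
pose T := [set z | dot (w n) z @[n --> \oo] --> (0 : R)].
have TE z : T z = (dot (w n) z @[n --> \oo] --> (0 : R)) by [].
have Tx k : T (x k).
  apply/cvgrPdist_lt => e e0.
  have [N _ hN] := @near_infty_natSinv_lt R (PosNum e0).
  exists (maxn k N) => // n /=; rewrite geq_max => /andP[kn Nn].
  rewrite sub0r normrN; apply: lt_trans (hN _ Nn).
  by case: (hphi n) => _; exact.
have T0 : T 0.
  by rewrite TE; under eq_fun do rewrite linear0r; exact: cvg_cst.
have TD u v : T u -> T v -> T (u + v).
  move=> Tu Tv; rewrite TE -(addr0 (0 : R)).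
  by under eq_fun do rewrite dotDr; exact: cvgD.
have TZ a u : T u -> T (a *: u).
  move=> Tu; rewrite TE -(mulr0 a).
  by under eq_fun do rewrite dotZr; apply: cvgM => //; exact: cvg_cst.
have Tcl : closed T.
  apply: closed_approx => z hz; apply/cvgrPdist_lt => e e0.
  have B0 : 0 < M + `|p| + 1 by rewrite ltr_wpDl// addr_ge0.
  have [|v Tv zv] := hz (e / 2 / (M + `|p| + 1)); first by rewrite !divr_gt0.
  have e20 : 0 < e / 2 by rewrite divr_gt0.
  move/cvgrPdist_lt : Tv => /(_ _ e20); apply: filterS => n.
  rewrite !sub0r !normrN => hn.
  rewrite -(subrK v z) dotDr (le_lt_trans (ler_normD _ _))//.
  rewrite (splitr e) ler_ltD// (le_trans (normr_dot_le _ _))//.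
  move: zv; rewrite ltr_pdivlMr// => zv.
  have := wB n; have := normr_ge0 (z - v); have := normr_ge0 (w n); nra.
move=> z.
have [q0 Tq0 qT] := orthogonal_projection T0 TD TZ Tcl z.
pose q := z - q0.
have xq n : dot (x n) q = 0 by rewrite dotC; exact: qT.
have pq : dot p q = 0.
  rewrite -fp; apply: (lim_eq (fun n => dot (x n) q)) => //.
  by under eq_fun do rewrite xq; exact: cvg_cst.
have Tz : T z.
  rewrite -(subrK q0 z) -/q; apply: TD => //.
  rewrite TE; under eq_fun do rewrite /w dotDl dotNl xq pq subr0.
  exact: cvg_cst.
have -> : (fun n => dot ((x \o phi) n) z) = (fun n => dot (w n) z + dot p z).
  by apply/funext => n; rewrite /w -dotDl subrK.
by rewrite -[X in _ --> X]add0r; apply: cvgD => //; exact: cvg_cst.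
Qed.

End Hilbert.

(** * Real sequences and a one-sided limit *)

Lemma limn_inf_gt0_near (R : realType) (rho : nat -> R) :
  (forall n, 0 <= rho n <= 1) -> 0 < limn_inf rho ->
  exists2 r : R, 0 < r & exists N, forall n, (N <= n)%N -> r <= rho n.
Proof.
move=> rho01 inf0.
have bnd : bounded_fun rho.
  exists 1; split; first exact: num_real.
  move=> M M1 n _ /=; have /andP[r0 r1] := rho01 n.
  by rewrite ger0_norm// (le_trans r1)// ltW.
rewrite limn_infE// in inf0.
have [|_ [N _ <-] infN] := sup_gt _ inf0.
  by exists (infs rho 0%N); exists 0%N.
exists (infs rho N) => //; exists N => n Nn.
apply: ge_inf; last by exists n.
by apply: has_lbound_sdrop; exact: bounded_fun_has_lbound.
Qed.

(** From [N] on, a is nonincreasing and bounded below by 0, hence converges, and b is squeezed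
    between 0 and a n - a n.+1. It will serve with a n = |x n - u|^2. *)
Lemma decrease_cvg (R : realType) (a b : nat -> R) (N : nat) :
  (forall n, 0 <= a n) -> (forall n, 0 <= b n) ->
  (forall n, (N <= n)%N -> a n.+1 <= a n - b n) ->
  cvgn a /\ b n @[n --> \oo] --> (0 : R).
Proof.
move=> a0 b0 ab.
have cN : cvgn (fun n => a (n + N)%N).
  apply: nonincreasing_is_cvgn.
    apply/nonincreasing_seqP => n; rewrite addSn.
    by have := ab _ (leq_addl n N); have := b0 (n + N)%N; lra.
  by exists 0 => _ [n _ <-].
have /cvg_ex[/= l] := cN.
rewrite (cvg_shiftn N a) => al.
split; first by apply/cvg_ex; exists l.
apply: (@squeeze_cvgr _ _ _ _ (fun=> 0) (fun n => a n - a n.+1)).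
- exists N => // n /= /ab; have := b0 n => ->.
  by lra.
- exact: cvg_cst.
- by rewrite -(subrr l); apply: cvgB => //; rewrite cvg_shiftS.
Qed.

Lemma ge0_lim_right (R : realType) (a b : R) : 0 <= b ->
  (forall t, 0 < t <= 1 -> 0 <= a + t * b) -> 0 <= a.
Proof.
move=> b0 h; rewrite leNgt; apply/negP => a0.
have ba : 0 < b - a by lra.
(* If a < 0, this t lies in the unit interval and makes a + t b = t a < 0. *)
pose t := - a / (b - a).
have tE : t * (b - a) = - a by rewrite /t divfK// gt_eqF.
have t0 : 0 < t by rewrite divr_gt0//; lra.
have t1 : t <= 1 by rewrite ler_pdivrMr//; lra.
have := h t; rewrite t0 t1 => /(_ isT); nra.
Qed.

(** * Weak limits: closed convex sets and Opial's lemma *)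

Section Tseng.
Context (R : realType) (H : completeNormedModType R) (dot : {dot H for idfun}).
Hypothesis dotE : hilbert_dot dot.
Implicit Types (u v w : H) (a : R).

(** With q the projection of p, the products of p - q with u n - q are at most 0; the weak limit
    gives |p - q|^2 <= 0. *)
Lemma closed_convex_weakly_closed (C : set H) (u : nat -> H) (p : H) :
  convex_set C -> closed C -> (forall n, C (u n)) -> weakly_cvg dot u p -> C p.
Proof.
move=> Ccvx Ccl Cu up; have C0 : C !=set0 by exists (u 0%N).
have [CP _] := metric_projP dotE C0 Ccvx Ccl p.
set q := metric_proj C p in CP *.
suff -> : p = q by [].
apply/subr0_eq/(dot_eq0 dotE)/eqP; rewrite eq_le; apply/andP; split; last first.
  by rewrite dotE sqr_ge0.
rewrite dotDr dotNr (dotC dot (p - q) p).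
apply: (@ler_cvg_to _ \oo _ _ (fun n => dot (u n) (p - q) - dot (p - q) q)
    (fun=> 0) (dot p (p - q) - dot (p - q) q) 0).
- by apply: cvgB; [exact: up|exact: cvg_cst].
- exact: cvg_cst.
- apply: nearW => n; rewrite (dotC dot (u n)) -dotNr -dotDr.
  exact: metric_proj_dot_le0.
Qed.

(** The difference of the two sides is a (1 - a) |u - v|^2. *)
Lemma sqr_norm_convex_le u v a : 0 <= a <= 1 ->
  `|a *: u + (1 - a) *: v| ^+ 2 <= a * `|u| ^+ 2 + (1 - a) * `|v| ^+ 2.
Proof.
move=> /andP[a0 a1].
have : 0 <= a * (1 - a) * `|u - v| ^+ 2.
  by rewrite !mulr_ge0 ?sqr_ge0 ?subr_ge0.
by rewrite -!dotE !dot_lin (dotC dot v u) => h; lra.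
Qed.

(** All weak cluster points coincide: for p and q in [S], |x n - q|^2 - |x n - p|^2 is affine in x
    n, so <x n, p - q> converges; its limit is both <p, p - q> and <q, p - q>, whence p = q. *)
Lemma Opial (S : set H) (x : nat -> H) (M : R) :
  (forall n, `|x n| <= M) ->
  (forall u, S u -> cvgn (fun n => `|x n - u| ^+ 2)) ->
  (forall phi p, (forall n, (n <= phi n)%N) -> weakly_cvg dot (x \o phi) p ->
     S p) ->
  exists2 p, S p & weakly_cvg dot x p.
Proof.
move=> xM Scvg Scl.
have phioo (phi : nat -> nat) : (forall n, (n <= phi n)%N) -> phi @ \oo --> \oo.
  move=> hphi A [N _ NA]; exists N => // n /= Nn; apply: NA => /=.
  exact: leq_trans (hphi n).
have [phi [p [hphi xp]]] := bounded_weakly_cvg_subseq dotE xM.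
have Sp := Scl _ _ hphi xp.
exists p => //.
have uniq psi q : (forall n, (n <= psi n)%N) -> weakly_cvg dot (x \o psi) q ->
    q = p.
  move=> hpsi xq; have Sq := Scl _ _ hpsi xq.
  have /cvg_ex[l xl] : cvgn (fun n => dot (x n) (p - q)).
    have -> : (fun n => dot (x n) (p - q)) =
        (fun n => 2^-1 * ((`|x n - q| ^+ 2 - `|x n - p| ^+ 2)
           + (`|p| ^+ 2 - `|q| ^+ 2))).
      apply/funext => n; rewrite -!dotE !dot_lin (dotC dot p (x n)).
      by rewrite (dotC dot q (x n)); lra.
    apply: is_cvgM; first exact: is_cvg_cst.
    apply: is_cvgD; last exact: is_cvg_cst.
    by apply: is_cvgB; exact: Scvg.
  have lim (chi : nat -> nat) r : (forall n, (n <= chi n)%N) ->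
      weakly_cvg dot (x \o chi) r -> dot r (p - q) = l.
    move=> hchi xr; apply: (cvg_unique (@Rhausdorff R) (xr (p - q))).
    exact: (cvg_comp _ _ (phioo _ hchi) xl).
  apply/esym/subr0_eq/(dot_eq0 dotE).
  by rewrite dotDl dotNl (lim _ _ hphi xp) (lim _ _ hpsi xq) subrr.
(* If convergence failed at z, the indices [psi] would keep <x n, z> at distance e from <p, z>; a
   weakly convergent subsequence of these has limit p by uniqueness, a contradiction. *)
move=> z; apply/cvgrPdist_lt => e e0; apply: contrapT => nx.
have /choice[psi hpsi] : forall n, exists m, (n <= m)%N /\
    e <= `|dot p z - dot (x m) z|.
  move=> n; apply: contrapT => /forallNP hn; apply: nx.
  exists n => // m /= nm; rewrite ltNge; apply/negP => em.
  exact: (hn m).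
have [chi [q [hchi xq]]] := bounded_weakly_cvg_subseq dotE
   (x := x \o psi) (M := M) (fun n => xM _).
have qp : q = p.
  apply: (uniq (psi \o chi)) => // n /=.
  by case: (hpsi (chi n)) => h _; exact: leq_trans (hchi n) h.
rewrite qp in xq.
have /cvgrPdist_lt/(_ e e0)[N _ /(_ N (leqnn N))] := xq z.
by rewrite ltNge /=; case: (hpsi (chi N)) => _ ->.
Qed.

(** * One forward-backward-forward step, and weak cluster points *)

Section Operator.
Variables (C : set H) (F : H -> H) (L : R).
Hypotheses (Ccvx : convex_set C) (Ccl : closed C) (C0 : C !=set0).
Hypothesis L0 : 0 < L.
Hypothesis Flip : forall u v, `|F u - F v| <= L * `|u - v|.
Hypothesis Fpm : pseudo_monotone_on dot setT F.

(** The projection inequality at u and <F y, y - u> >= 0, from pseudo-monotonicity, add up to l <F x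
    - F y, y - u> <= <x - y, y - u>. This compares the cross terms once both squares are expanded
    around y - u. *)
Lemma Tseng_step_le u x y l : VI_solutions dot F C u -> 0 < l ->
  y = metric_proj C (x - l *: F x) ->
  `|y + l *: (F x - F y) - u| ^+ 2 <=
  `|x - u| ^+ 2 - `|x - y| ^+ 2 + (l * `|F x - F y|) ^+ 2.
Proof.
move=> [Cu VIu] l0 yE.
have [Cy _] := metric_projP dotE C0 Ccvx Ccl (x - l *: F x).
rewrite -yE in Cy.
have := metric_proj_dot_le0 dotE C0 Ccvx Ccl (x - l *: F x) Cu.
rewrite -yE => hP.
have hF : 0 <= l * dot (F y) (y - u).
  by rewrite mulr_ge0 ?(ltW l0)//; apply: Fpm => //; exact: VIu.
have -> : (l * `|F x - F y|) ^+ 2 = `|l *: (F x - F y)| ^+ 2.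
  by rewrite normrZ gtr0_norm.
have -> : y + l *: (F x - F y) - u = (y - u) + l *: (F x - F y).
  by rewrite addrAC.
have -> : x - u = (y - u) + (x - y) by rewrite [RHS]addrC addrA subrK.
rewrite !(sqr_normD dotE (y - u)) !dotZr.
move: hP hF.
have -> : x - l *: F x - y = (x - y) - l *: (F x - F y) - l *: F y.
  by rewrite scalerBr opprB addrA addrAC (addrAC _ _ (- y)) addrK addrAC.
rewrite -(opprB y u) dotNr !(dotDl _ _ _ (y - u)) !dotNl !dotZl.
rewrite (dotC dot (y - u) (x - y)) (dotC dot (y - u) (F x - F y)).
by rewrite !(dotDl _ _ _ (y - u)) !dotNl => hP hF; lra.
Qed.

(** The hypotheses link x, y and l only at equal indices, so they survive passing to a subsequence;
    x is meant to be one with weak limit p. *)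
Lemma weak_limit_VI_solution (x y : nat -> H) (l : nat -> R) (m M : R) (p : H) :
  seq_weak_continuous dot F ->
  0 < m -> (forall n, m <= l n) ->
  (forall n, y n = metric_proj C (x n - l n *: F (x n))) ->
  (forall n, `|y n| <= M) -> `|x n - y n| @[n --> \oo] --> (0 : R) ->
  weakly_cvg dot x p -> VI_solutions dot F C p.
Proof.
move=> Fweak m0 ml yE yM xy xp.
have Cy n : C (y n).
  by rewrite yE; case: (metric_projP dotE C0 Ccvx Ccl (x n - l n *: F (x n))).
have yp : weakly_cvg dot y p.
  move=> z.
  have -> : (fun n => dot (y n) z) = (fun n => dot (x n) z - dot (x n - y n) z).
    by apply/funext => n; rewrite dotDl dotNl opprB addrC subrK.
  rewrite -[X in _ --> X]subr0; apply: cvgB; first exact: xp.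
  rewrite -(linear0l dot z); apply: (cvg_dotl dotE).
  exact/norm_cvg0P.
have Cp : C p by exact: closed_convex_weakly_closed yp.
have Fyp := Fweak _ _ yp.
split => // c Cc.
have [Fp0|/eqP Fp0] := pselect (F p = 0); first by rewrite Fp0 linear0l.
pose w := F p.
have w0 : 0 < dot w w by rewrite dotE exprn_gt0// normr_gt0.
(* The projection inequality bounds <F (x n), c' - y n> below by -|x n - y n| |c' - y n| / l n,
   where l n >= m; replacing F (x n) by F (y n) costs the Lipschitz term with [L]. *)
have lowb c' : C c' -> forall n,
    - ((m^-1 + L) * (`|c'| + M)) * `|x n - y n| <= dot (F (y n)) (c' - y n).
  move=> Cc' n.
  have := metric_proj_dot_le0 dotE C0 Ccvx Ccl (x n - l n *: F (x n)) Cc'.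
  rewrite -yE => hP.
  have cyM : `|c' - y n| <= `|c'| + M.
    by rewrite (le_trans (ler_normB _ _))// lerD2l.
  have ln0 : 0 < l n by exact: lt_le_trans (ml n).
  have h1 : - m^-1 * (`|x n - y n| * `|c' - y n|) <= dot (F (x n)) (c' - y n).
    have h2 : dot (x n - y n) (c' - y n) <= l n * dot (F (x n)) (c' - y n).
      by move: hP; rewrite addrAC (dotDl dot (x n - y n)) dotNl dotZl subr_le0.
    have h3 := normr_dot_le dotE (x n - y n) (c' - y n).
    have {h3} h3 := lerNnormlW h3.
    have h4 : - (`|x n - y n| * `|c' - y n|) <= l n * dot (F (x n)) (c' - y n).
      exact: le_trans h2.
    rewrite -(ler_pM2l ln0) (le_trans _ h4)// mulrA mulrN mulNr lerN2.
    rewrite ler_peMl ?mulr_ge0// ler_pdivlMr// mul1r//.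
  have h2 : - (L * `|x n - y n| * `|c' - y n|) <=
      dot (F (y n) - F (x n)) (c' - y n).
    have h3 := lerNnormlW (normr_dot_le dotE (F (y n) - F (x n)) (c' - y n)).
    apply: le_trans h3; rewrite lerN2 ler_wpM2r// distrC.
    exact: Flip.
  rewrite -(subrK (F (x n)) (F (y n))) dotDl.
  apply: le_trans (lerD h2 h1).
  have : (m^-1 + L) * `|x n - y n| * `|c' - y n| <=
         (m^-1 + L) * `|x n - y n| * (`|c'| + M).
    by rewrite ler_wpM2l// mulr_ge0// addr_ge0 ?invr_ge0 ?ltW.
  by move: (m^-1) => k; lra.
(* The bound in [lowb] tends to 0 while t <F (y n), w> tends to t |w|^2 > 0 by weak continuity,
   hence eventual nonnegativity. Pseudo-monotonicity then puts F at the fixed point c' + t w, so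
   that the weak limit of y n can be taken. *)
have shifted c' t : C c' -> 0 < t ->
    0 <= dot (F (c' + t *: w)) (c' + t *: w - p).
  move=> Cc' t0.
  have ev : \forall n \near \oo, 0 <= dot (F (y n)) (c' + t *: w - y n).
    pose A := (m^-1 + L) * (`|c'| + M).
    have : (- A * `|x n - y n| + t * dot (F (y n)) w) @[n --> \oo] -->
           - A * 0 + t * dot w w.
      by apply: cvgD; apply: cvgM;
        [exact: cvg_cst|exact: xy|exact: cvg_cst|exact: Fyp].
    have pos : 0 < - A * 0 + t * dot w w by rewrite mulr0 add0r mulr_gt0.
    move=> /cvgr_gt/(_ _ pos); apply: filterS => n hn.
    have -> : c' + t *: w - y n = (c' - y n) + t *: w by rewrite addrAC.
    rewrite dotDr dotZr (le_trans (ltW hn))// lerD2r.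
    exact: lowb.
  set c2 := c' + t *: w in ev *.
  rewrite dotDr dotNr (dotC dot _ p).
  apply: (@ler_cvg_to _ \oo _ _ (fun=> 0)
      (fun n => dot (F c2) c2 - dot (y n) (F c2))).
  - exact: cvg_cst.
  - by apply: cvgB; [exact: cvg_cst|exact: yp].
  - apply: filterS ev => n /Fpm - /(_ I I).
    by rewrite dotDr dotNr (dotC dot _ (y n)).
(* [K] bounds |v| for v = (c - p) + t w and t <= 1. The Lipschitz bound gives <F (p + t v), v> <=
   <w, c - p> + t (|w|^2 + L K^2), whence the coefficient passed to [ge0_lim_right]. *)
pose K := `|c - p| + `|w|.
apply: (@ge0_lim_right _ _ (L * K ^+ 2 + dot w w)).
  by apply: addr_ge0; [apply: mulr_ge0; [exact: ltW|exact: sqr_ge0]|exact: ltW].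
move=> t /andP[t0 t1].
(* Perturbing by t^2 *: w instead of t *: w lets a factor t be cancelled. *)
pose v := (c - p) + t *: w.
have vK : `|v| <= K.
  rewrite (le_trans (ler_normD _ _))// lerD2l normrZ gtr0_norm//.
  by rewrite ler_piMl.
have Cc' : C (p + t *: (c - p)) by apply: convex_set_segment => //; rewrite ltW.
have := shifted _ (t ^+ 2) Cc'; rewrite exprn_gt0// => /(_ isT).
have -> : p + t *: (c - p) + t ^+ 2 *: w = p + t *: v.
  by rewrite /v (scalerDr _ (c - p)) scalerA expr2 addrA.
rewrite addrAC subrr add0r dotZr pmulr_rge0// => hv.
have : dot (F (p + t *: v) - F p) v <= L * t * K ^+ 2.
  apply: (le_trans (dot_le dotE _ _)).
  have := Flip (p + t *: v) p.
  rewrite addrAC subrr add0r normrZ gtr0_norm// => hL.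
  apply: (@le_trans _ _ (L * (t * `|v|) * `|v|)); first by rewrite ler_wpM2r.
  have : L * t * (`|v| * `|v|) <= L * t * (K * K).
    by apply: ler_wpM2l; [apply: mulr_ge0; exact: ltW|exact: ler_pM].
  by rewrite expr2; lra.
rewrite dotDl dotNl.
have -> : dot (F p) v = dot w (c - p) + t * dot w w by rewrite /v dotDr dotZr.
rewrite -/w; lra.
Qed.

End Operator.
End Tseng.

(** * Adaptive step sizes *)

Lemma adaptive_stepsize (R : realType) (mu L : R) (e g l : nat -> R) :
  0 < mu < 1 -> 0 < L -> 0 < l 0%N -> (forall n, 0 < e n) ->
  (forall n, 0 <= g n <= L * e n) ->
  (forall n, l n.+1 =
     if g n != 0 then Num.min (mu * e n / g n) (l n) else l n) ->
  exists m q : R, exists N,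
    [/\ 0 < m, forall n, m <= l n, 0 <= q < 1 &
        forall n, (N <= n)%N -> l n * g n <= q * e n].
Proof.
move=> /andP[mu0 mu1] L0 l00 e0 gL lS.
(* Since g n <= L e n, the quotient mu e n / g n is at least mu / L whenever g n > 0. *)
pose m := Num.min (l 0%N) (mu / L).
have m0 : 0 < m by rewrite lt_min l00 divr_gt0.
have ml n : m <= l n.
  elim: n => [|n IH]; first by rewrite ge_min lexx.
  rewrite lS; case: ifPn => // gn0; have /andP[gn gLn] := gL n.
  have {}gn : 0 < g n by rewrite lt_def gn0.
  rewrite le_min IH andbT ge_min; apply/orP; right.
  rewrite ler_pdivrMr// mulrAC ler_pdivlMr// -!mulrA ler_pM2l//.
  by rewrite mulrC.
have lle n : l n.+1 <= l n.
  by rewrite lS; case: ifPn => // _; rewrite ge_min lexx orbT.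
have lg n : l n.+1 * g n <= mu * e n.
  have /andP[gn _] := gL n.
  have [g0|gn0] := eqVneq (g n) 0.
    by rewrite g0 mulr0 mulr_ge0 ?ltW.
  have {}gn : 0 < g n by rewrite lt_def gn0.
  by rewrite -ler_pdivlMr// lS gn0 ge_min lexx.
have /cvg_ex[/= l' ll'] : cvgn l.
  apply: nonincreasing_is_cvgn; first exact/nonincreasing_seqP.
  by exists m => _ [n _ <-].
have l'0 : 0 < l'.
  apply: (lt_le_trans m0).
  apply: (@ler_cvg_to _ \oo _ _ (fun=> m) l m l') => //; first exact: cvg_cst.
  exact: nearW.
(* The update rule controls l n.+1 g n, one index ahead of the wanted l n g n. As l has a positive
   limit and q, the midpoint of mu and 1, exceeds mu, eventually mu l n < q l n.+1; this trades l
   n.+1 for l n at the price of replacing mu by q. *)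
pose q := (1 + mu) / 2.
have qlim : q * l n.+1 - mu * l n @[n --> \oo] --> q * l' - mu * l'.
  apply: cvgB; apply: cvgM => //; try exact: cvg_cst.
  by rewrite (cvg_shiftS l).
have pos : 0 < q * l' - mu * l'.
  by rewrite -mulrBl mulr_gt0// /q; lra.
have [N _ hN] := cvgr_gt _ qlim _ pos.
exists m, q, N; split => //; first by rewrite /q; lra.
move=> n /hN /= hn; rewrite -(ler_pM2l mu0).
have /andP[gn _] := gL n.
have h1 : mu * l n * g n <= q * l n.+1 * g n.
  by rewrite ler_wpM2r//; lra.
have q0 : 0 <= q by rewrite /q; lra.
have h2 : q * (l n.+1 * g n) <= q * (mu * e n) by rewrite ler_wpM2l.
lra.
Qed.

(** * Fejer monotonicity of the iterates and passage to the weak limit *)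

Theorem mainTheorem8 (R : realType) (H : completeNormedModType R)
    (dot : {dot H for idfun}) (dotE : hilbert_dot dot)
    (C : set H) (C_nonempty : C !=set0) (C_convex : convex_set C)
    (C_closed : closed C)
    (F : H -> H) (Omega_nonempty : VI_solutions dot F C !=set0)
    (F_pseudo_monotone : pseudo_monotone_on dot setT F)
    (L : R) (L_gt0 : 0 < L) (F_lipschitz : L.-lipschitz F)
    (F_weak_continuous : seq_weak_continuous dot F)
    (rho : nat -> R) (rho_ge0_le1 : forall n : nat, 0 <= rho n <= 1)
    (rho_liminf : 0 < limn_inf rho)
    (mu : R) (mu_gt0_lt1 : 0 < mu < 1)
    (x y : nat -> H) (lambda : nat -> R) (lambda0_gt0 : 0 < lambda 0%N)
    (yE : forall n : nat, y n = metric_proj C (x n - lambda n *: F (x n)))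
    (xS : forall n : nat,
        x n.+1 = rho n *: (y n + lambda n *: (F (x n) - F (y n)))
                 + (1 - rho n) *: x n)
    (lambdaS : forall n : nat,
        lambda n.+1 =
          if F (x n) - F (y n) != 0
          then Num.min (mu * `|x n - y n| / `|F (x n) - F (y n)|) (lambda n)
          else lambda n)
    (x_neq_y : forall n : nat, x n <> y n)
    (Fy_neq0 : forall n : nat, F (y n) <> 0) :
  exists2 xs : H, VI_solutions dot F C xs & weakly_cvg dot x xs.
Proof.
have Flip u v : `|F u - F v| <= L * `|u - v|.
  exact: (F_lipschitz (u, v) (conj I I)).
have xy0 n : 0 < `|x n - y n|.
  by rewrite normr_gt0 subr_eq0; apply/eqP; exact: x_neq_y.
have [||||m [q [N [m0 ml /andP[q0 q1] lq]]]] :=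
    @adaptive_stepsize R mu L (fun n => `|x n - y n|)
      (fun n => `|F (x n) - F (y n)|) lambda mu_gt0_lt1 L_gt0.
- exact: lambda0_gt0.
- exact: xy0.
- by move=> n; rewrite normr_ge0 Flip.
- by move=> n; rewrite normr_eq0.
have [r r0 [N' rN]] := limn_inf_gt0_near rho_ge0_le1 rho_liminf.
(* Here r bounds rho n below, and 1 - q^2 is the share of |x n - y n|^2 left in [Tseng_step_le] once
   lambda n |F (x n) - F (y n)| <= q |x n - y n|. *)
pose K := r * (1 - q ^+ 2).
have K0 : 0 < K by rewrite mulr_gt0// subr_gt0 expr_lt1.
have fejer u n : VI_solutions dot F C u -> (maxn N N' <= n)%N ->
    `|x n.+1 - u| ^+ 2 <= `|x n - u| ^+ 2 - K * `|x n - y n| ^+ 2.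
  move=> Su; rewrite geq_max => /andP[Nn N'n].
  have step := Tseng_step_le dotE C_convex C_closed C_nonempty F_pseudo_monotone
    Su (lt_le_trans m0 (ml n)) (yE n).
  (* The relaxed step is a convex combination with weight rho n, so [sqr_norm_convex_le] reduces the
     estimate to the unrelaxed step. *)
  have -> : x n.+1 - u = rho n *: (y n + lambda n *: (F (x n) - F (y n)) - u)
      + (1 - rho n) *: (x n - u).
    rewrite xS !scalerBr addrACA -opprD -scalerDl.
    by rewrite (addrC (rho n)) subrK scale1r.
  apply: (le_trans (sqr_norm_convex_le dotE _ _ (rho_ge0_le1 n))).
  have /andP[rho0 rho1] := rho_ge0_le1 n.
  have lq2 : (lambda n * `|F (x n) - F (y n)|) ^+ 2 <=
      q ^+ 2 * `|x n - y n| ^+ 2.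
    rewrite -exprMn ler_pXn2r ?nnegrE ?lq//.
      by rewrite mulr_ge0// ltW// (lt_le_trans m0).
    by rewrite mulr_ge0.
  have hr : K * `|x n - y n| ^+ 2 <= rho n * (1 - q ^+ 2) * `|x n - y n| ^+ 2.
    rewrite ler_wpM2r ?sqr_ge0// ler_wpM2r ?rN// subr_ge0.
    by rewrite expr_le1// ltW.
  have hstep := ler_wpM2l rho0 (le_trans step (lerD (lexx _) lq2)).
  apply: (le_trans (lerD hstep (lexx _))).
  lra.
have [u0 Su0] := Omega_nonempty.
have sqcvg u : VI_solutions dot F C u ->
    cvgn (fun n => `|x n - u| ^+ 2) /\
    K * `|x n - y n| ^+ 2 @[n --> \oo] --> (0 : R).
  move=> Su; apply: (@decrease_cvg _ _ _ (maxn N N')).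
  - by move=> n; exact: sqr_ge0.
  - by move=> n; rewrite mulr_ge0 ?sqr_ge0// ltW.
  - by move=> n; exact: fejer.
have [cx0 Ke0] := sqcvg _ Su0.
have e0 : `|x n - y n| @[n --> \oo] --> (0 : R).
  apply/cvgr0Pnorm_lt => e ee.
  have Ke : 0 < K * e ^+ 2 by rewrite mulr_gt0// exprn_gt0.
  move/cvgr0Pnorm_lt : Ke0 => /(_ _ Ke); apply: filterS => n.
  rewrite normr_id normrM gtr0_norm// normrX normr_id ltr_pM2l//.
  by rewrite ltr_pXn2r ?nnegrE// ltW.
have bndl (a : nat -> R) : cvgn a -> exists2 B, 0 <= B & forall n, `|a n| <= B.
  move=> /cvg_seq_bounded[B [_ hB]].
  exists (`|B| + 1); first by rewrite addr_ge0.
  by move=> n; apply: hB => //; rewrite ltr_pwDr// ler_norm.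
have [B B0 hB] := bndl _ cx0.
(* [B] bounds the squares |x n - u0|^2, and s^2 <= B implies s <= B + 1, which avoids a square
   root. *)
have xM n : `|x n| <= B + 1 + `|u0|.
  rewrite -(subrK u0 (x n)) (le_trans (ler_normD _ _))// lerD2r.
  have := hB n; rewrite ger0_norm ?sqr_ge0// => hn.
  have := normr_ge0 (x n - u0); nra.
have [|E E0 hE] := bndl (fun n => `|x n - y n|).
  by apply/cvg_ex; exists 0.
have yM n : `|y n| <= B + 1 + `|u0| + E.
  have -> : y n = x n - (x n - y n) by rewrite opprB addrC subrK.
  rewrite (le_trans (ler_normB _ _))// lerD//.
  by have := hE n; rewrite normr_id.
apply: (Opial dotE xM); first by move=> u /sqcvg[].
move=> phi p hphi xp.
apply: (@weak_limit_VI_solution _ _ _ dotE C F L C_convex C_closed C_nonempty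
  L_gt0 Flip F_pseudo_monotone (x \o phi) (y \o phi) (lambda \o phi) m
  (B + 1 + `|u0| + E)) => //.
- by move=> n; exact: ml.
- by move=> n; exact: yE.
- by move=> n; exact: yM.
- apply: (cvg_comp phi (fun n => `|x n - y n|) _ e0).
  move=> A [k _ kA]; exists k => // n /= kn; apply: kA => /=.
  exact: leq_trans (hphi n).
Qed.
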